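(* Let $n\ge 1$. For every rooted tree $T$ with $n$ leaves and no vertex having exactly one child, we have $\rho_C(T)\le\rho_C(C_n)$, where $C_n$ is the binary caterpillar with $n$ leaves.
   Context: A rooted tree $T$ has a distinguished vertex $r$, the root; the level $\ell(v)$ of a vertex $v$ is its distance from $r$. A leaf is a vertex without children (the root counts as a leaf only if it is the only vertex). For vertices $v,w$, $v\vee w$ denotes the common ancestor of $v$ and $w$ farthest from the root (every vertex is an ancestor of itself). If $v_1,\ldots,v_n$ are the leaves, the ancestral matrix $C(T)$ is the $n\times n$ matrix with $(i,j)$ entry $\ell(v_i\vee v_j)$, and $\rho_C(T)$ is its largest eigenvalue. The binary caterpillar $C_n$ is the rooted tree with $n-1$ internal (non-leaf) vertices which form a path with the root at one end, each internal vertex having exactly two children (so $C_n$ has exactly $n$ leaves; $C_1$ is a single vertex). *)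

(* Defs.v *)
From HB Require Import structures.
From mathcomp Require Import all_boot all_order all_algebra.
From mathcomp Require Import boolp classical_sets reals.
From mathcomp Require Import zify.
Set Implicit Arguments.
Unset Strict Implicit.
Unset Printing Implicit Defensive.
Import Order.TTheory GRing.Theory Num.Theory.

(* Finite rooted trees up to isomorphism: a simple graph in which any two     *)
(* vertices are joined by exactly one path, with a distinguished vertex.      *)
Record rooted_tree := RootedTree {
  vertex :> finType;
  edge : rel vertex;
  troot : vertex;
  edge_sym : symmetric edge;
  edge_irr : irreflexive edge;
  edge_tree : forall x y : vertex,
    exists! p : seq vertex, [/\ path edge x p, uniq (x :: p) & last x p = y] }.

Arguments troot T : rename.

Section RootedTreeTheory.
Variable T : rooted_tree.
Implicit Types u v w : T.

(* [find] returns the least length k of a walk from u to v; some walk has     *)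
(* length less than #|T| since T is connected.                                *)
Definition dist u v : nat :=
  find (fun k => `[< exists p : seq T,
                     [/\ size p = k, path (@edge T) u p & last u p = v] >])
       (iota 0 #|T|).

Definition level v : nat := dist (troot T) v.

(* u lies on the path from the root to v; in particular u is an ancestor of u *)
Definition ancestor u v : bool :=
  `[< exists p : seq T, [/\ path (@edge T) (troot T) p, uniq (troot T :: p),
                            last (troot T) p = v & u \in troot T :: p] >].

Definition join v w : T :=
  [arg max_(u > troot T | ancestor u v && ancestor u w) level u]%N.

Definition children v : {set T} := [set w | edge v w & ancestor v w].

Definition leaves : {set T} := [set v | children v == finset.set0].

End RootedTreeTheory.

Arguments leaves T : clear implicits.

Definition ancestral_mx (R : realType) (T : rooted_tree) : 'M[R]_#|leaves T| :=
  \matrix_(i, j) ((level (join (enum_val i) (enum_val j)))%:R)%R.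

Definition largest_eigenvalue (R : realType) (m : nat) (A : 'M[R]_m) (a : R) :=
  eigenvalue A a /\ (forall b : R, eigenvalue A b -> (b <= a)%R).

(* The ancestral matrix is real symmetric of positive order, so it does have  *)
(* a largest eigenvalue and the default value 0 of [xget] plays no role.      *)
Definition rho_C (R : realType) (T : rooted_tree) : R :=
  xget 0%R (largest_eigenvalue (ancestral_mx R T)).

(* For 0 < n, this determines T up to isomorphism. The sequence s lists the   *)
(* internal vertices along the path they form, starting at the root. It is    *)
(* empty when n = 1, and T is then a single vertex.                           *)
Definition binary_caterpillar (n : nat) (T : rooted_tree) : Prop :=
  exists s : seq T,
    [/\ size s = n.-1, uniq s & s =i [pred v | v \notin leaves T]] /\
    [/\ sorted (@edge T) s, head (troot T) s = troot T
      & forall v : T, v \in s -> #|children v| = 2].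

(* Existence of the binary caterpillar with k + 1 leaves: its vertices are    *)
(* 0, ..., 2k, the internal ones are 0, 2, ..., 2k - 2, and the children of   *)
(* an internal vertex i are i + 1 and i + 2.                                  *)
Section Caterpillar.
Variable k : nat.
Let V := 'I_(k.*2.+1).
Implicit Types x y z : V.

Let par (i : nat) : nat := (i.-1)./2.*2.

Definition cat_edge : rel V :=
  fun x y => ((0 < x) && (par x == y)) || ((0 < y) && (par y == x)).

Lemma cat_edge_sym : symmetric cat_edge.
Proof. by move=> x y; rewrite /cat_edge orbC. Qed.

Lemma par_lt i : 0 < i -> par i < i.
Proof. rewrite /par; lia. Qed.

Lemma par_le i : par i <= i.
Proof. rewrite /par; lia. Qed.

Lemma cat_edge_irr : irreflexive cat_edge.
Proof. by move=> x; rewrite /cat_edge /par; lia. Qed.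

Lemma iter_par_le j i : iter j par i <= i.
Proof. by elim: j => //= j IH; apply: leq_trans (par_le _) IH. Qed.

Lemma cat_descend x c p : path cat_edge c p -> x \notin c :: p ->
  (exists j, iter j.+1 par c = x) -> x < last c p.
Proof.
elim: p c => [|d p IH] c /=.
  move=> _; rewrite inE => xc [j hj].
  have := iter_par_le j.+1 c; rewrite /= hj => le.
  by rewrite ltn_neqAle le andbT; apply: contraNneq xc => e; apply/eqP/val_inj.
case/andP=> ecd pp; rewrite inE negb_or => /andP[xc xdp] [j hj].
apply: (IH d pp xdp).
case/orP: ecd => /andP[_ /eqP e].
  case: j hj => [|j] hj; last by exists j; move: hj; rewrite iterSr e.
  by move: xdp; rewrite inE negb_or => /andP[/eqP]; case; apply: val_inj; exact: etrans (esym hj) e.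
by exists j.+1; rewrite iterSr e.
Qed.

Lemma cat_first_step x d p : path cat_edge x (d :: p) -> uniq (x :: d :: p) ->
  last d p <= x -> par x = d /\ 0 < x.
Proof.
case/andP=> exd pp /andP[xn _] le.
case/orP: exd => /andP[x0 /eqP e]; first by split.
have : x < last d p by apply: (cat_descend pp xn); exists 0.
by rewrite ltnNge le.
Qed.

Lemma rev_path x p : path cat_edge x p -> uniq (x :: p) ->
  exists q, [/\ path cat_edge (last x p) q, uniq (last x p :: q),
                last (last x p) q = x & last x p :: q = rev (x :: p)].
Proof.
move=> pp up; exists (rev (belast x p)).
have E : last x p :: rev (belast x p) = rev (x :: p).
  by rewrite [in RHS]lastI rev_rcons.
split=> //.
- by rewrite rev_path; apply: sub_path pp => u v; rewrite cat_edge_sym.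
- by rewrite E rev_uniq.
- by case: p {pp up E} => //= d p; rewrite rev_cons last_rcons.
Qed.

Lemma cat_unique m x y p q : x + y < m ->
  path cat_edge x p -> uniq (x :: p) -> last x p = y ->
  path cat_edge x q -> uniq (x :: q) -> last x q = y -> p = q.
Proof.
elim: m x y p q => // m IH.
have key x y p q : y <= x -> x + y < m.+1 ->
  path cat_edge x p -> uniq (x :: p) -> last x p = y ->
  path cat_edge x q -> uniq (x :: q) -> last x q = y -> p = q.
  move=> yx xym.
  case: p => [|d p] pp up lp; case: q => [|e q] pq uq lq //.
  - case/andP: uq => /negP[]; have <- : last e q = x := etrans lq (esym lp).
    exact: mem_last.
  - case/andP: up => /negP[]; have <- : last d p = x := etrans lp (esym lq).
    exact: mem_last.
  have [|xd x0] := cat_first_step pp up; first by rewrite /= in lp; rewrite lp.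
  have [|xe _] := cat_first_step pq uq; first by rewrite /= in lq; rewrite lq.
  have de : d = e by apply: val_inj; exact: etrans (esym xd) xe.
  subst e; congr cons.
  apply: (IH d y).
  - by have := par_lt x0; rewrite xd; lia.
  - by case/andP: pp.
  - by case/andP: up.
  - by [].
  - by case/andP: pq.
  - by case/andP: uq.
  - by [].
move=> x y p q xym pp up lp pq uq lq.
case: (leqP y x) => [yx|/ltnW xy]; first exact: (key x y).
have [p' [pp' up' lp' rp]] := rev_path pp up.
have [q' [pq' uq' lq' rq]] := rev_path pq uq.
rewrite lp in pp' up' lp' rp; rewrite lq in pq' uq' lq' rq.
have e : p' = q' by apply: (key y x) => //; rewrite addnC.
by move: rp; rewrite e rq => /(can_inj revK) [].
Qed.

Lemma cat_connect0 x : connect cat_edge x ord0.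
Proof.
have [m] := ubnP (x : nat); elim: m x => // m IH x xm.
case: (posnP x) => [x0|x0]; first by rewrite (_ : x = ord0) //; apply: val_inj.
have lt : par x < k.*2.+1 by apply: leq_ltn_trans (par_le _) (ltn_ord x).
apply: (connect_trans (y := Ordinal lt)); last first.
  by apply: IH => /=; have := par_lt x0; lia.
by apply: connect1; rewrite /cat_edge x0 /= eqxx.
Qed.

Lemma cat_edge_tree x y :
  exists! p : seq V, [/\ path cat_edge x p, uniq (x :: p) & last x p = y].
Proof.
have : connect cat_edge x y.
  apply: connect_trans (cat_connect0 x) _.
  by rewrite (sym_connect_sym cat_edge_sym) cat_connect0.
case/connectP=> p pp ->; case/shortenP: pp => q pq uq _.
exists q; split=> // r [pr ur lr].
by apply: (cat_unique (ltnSn _) pq uq _ pr ur lr).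
Qed.

Definition caterpillar : rooted_tree :=
  @RootedTree V cat_edge ord0 cat_edge_sym cat_edge_irr cat_edge_tree.

Lemma cat_root_path_le y q : path cat_edge y q -> uniq (y :: q) ->
  last y q = ord0 -> forall u, u \in y :: q -> u <= y.
Proof.
elim: q y => [|d q IH] y pq uq lq u; first by rewrite inE => /eqP ->.
have [|yd y0] := cat_first_step pq uq; first by move: lq => /= ->.
rewrite inE => /orP[/eqP -> //|uin].
apply: (@leq_trans d); last by rewrite -yd par_le.
by apply: IH uin => //; [case/andP: pq | case/andP: uq].
Qed.

Lemma cat_ancestor_par (x y : caterpillar) : 0 < y -> par y = x -> ancestor x y.
Proof.
move=> y0 yx; apply/asboolP.
have [p [[pp up lp] _]] := edge_tree (troot caterpillar) y.
exists p; split=> //.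
have [q [pq uq lq rq]] := rev_path pp up.
rewrite -mem_rev -rq.
rewrite lp in pq uq lq *.
case: q pq uq lq {rq} => [|d q] pq uq lq.
  by move: y0; rewrite (_ : y = ord0 :> V).
have [|yd _] := cat_first_step pq uq; first by move: lq => /= ->.
by rewrite (_ : x = d) ?inE ?eqxx ?orbT //; apply: val_inj; exact: etrans (esym yx) yd.
Qed.

Lemma cat_ancestor_le (x y : caterpillar) : ancestor x y -> x <= y.
Proof.
move=> /asboolP[p [pp up lp xp]].
have [q [pq uq lq rq]] := rev_path pp up.
rewrite lp in pq uq lq rq.
by apply: (cat_root_path_le pq uq lq); rewrite rq mem_rev.
Qed.

Lemma cat_in_children (x y : caterpillar) :
  (y \in children x) = (0 < y) && (par y == x).
Proof.
rewrite inE; apply/andP/andP => [[exy /cat_ancestor_le xy]|[y0 /eqP yx]].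
  case/orP: exy => /andP[z0 /eqP e]; last by rewrite e eqxx.
  by have := par_lt z0; rewrite e ltnNge xy.
by split; [apply/orP; right; rewrite y0 yx eqxx | exact: cat_ancestor_par].
Qed.

Lemma cat_in_leaves (x : caterpillar) :
  (x \in leaves caterpillar) = ~~ (~~ odd x && (x < k.*2)).
Proof.
rewrite inE; apply/eqP/idP => [c0|].
  apply/negP => /andP[ox xk].
  have lt : x.+1 < k.*2.+1 by [].
  have : (Ordinal lt : caterpillar) \in children x.
    by rewrite cat_in_children /= /par; lia.
  by rewrite c0 inE.
move=> h; apply/setP => y; rewrite [in RHS]inE cat_in_children.
apply/negbTE/negP => /andP[y0 /eqP yx]; have := ltn_ord y.
move: yx h; rewrite /par; lia.
Qed.

Lemma caterpillarP : binary_caterpillar k.+1 caterpillar.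
Proof.
have lt (j : nat) : j \in iota 0 k -> j.*2 < k.*2.+1.
  by rewrite mem_iota; lia.
exists [seq (inord j.*2 : 'I_(k.*2.+1)) | j <- iota 0 k]; split; split.
- by rewrite size_map size_iota.
- rewrite map_inj_in_uniq ?iota_uniq // => i j /lt hi /lt hj /(congr1 val).
  by rewrite /= !inordK //; lia.
- move=> x; rewrite inE cat_in_leaves negbK.
  apply/mapP/andP => [[j jk ->]|[ox xk]].
    rewrite inordK ?lt // odd_double; split=> //.
    by move: jk; rewrite mem_iota; lia.
  exists (x : nat)./2; first by rewrite mem_iota; lia.
  by apply: val_inj; rewrite /= inordK; lia.
- rewrite sorted_map.
  have: sorted (fun i j => j == i.+1) (iota 0 k).
    by elim: k 0 => // -[|m] IH i //=; rewrite eqxx; exact: (IH i.+1).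
  apply: sub_in_sorted (allss _) => i j /lt hi /lt hj /eqP ji.
  by apply/orP; right; rewrite !inordK // /par; lia.
- case E: (iota 0 k) => [|i l] //=; apply: val_inj; rewrite /=.
  by rewrite (_ : i = 0) ?inordK //; move: E; clear; case: k => //= m [].
- move=> x /mapP[j jk ->]; have := jk; rewrite mem_iota /= add0n => {}jk.
  rewrite (_ : children _ = [set ((inord (j.*2.+1) : 'I_(k.*2.+1)) : caterpillar);
      (inord (j.*2.+2) : 'I_(k.*2.+1))]).
    rewrite cards2 -val_eqE /= !inordK; lia.
  apply/setP => y; rewrite cat_in_children !inE -!val_eqE /= /par !inordK; lia.
Qed.

End Caterpillar.

(* Main.v *)
(* For x : leaves -> R, the quadratic form of the ancestral matrix is the sum of
   S(u)^2 over the vertices u other than the root, where S(u) is the sum of x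
   over the leaves below u; it does not decrease when x is replaced by |x|.
   Let P_k be the sum of the k largest values of x >= 0. The leaf sets of the
   internal vertices of T form a laminar family of distinct sets of size at
   least 2, so at most n + 1 - k of them have size at least k; hence the sum of
   S(u)^2 over the internal vertices is at most the sum of P_k^2 for
   2 <= k <= n. In the caterpillar the leaf sets of the internal vertices form a
   chain, and placing the largest values of x deepest makes these sums attain
   P_2, ..., P_n. The two Rayleigh quotients then compare. *)

From HB Require Import structures.
Require Import Defs.
From mathcomp Require Import all_boot all_order all_algebra.
From mathcomp Require Import boolp classical_sets reals.
From mathcomp Require Import fintype finset.
From mathcomp Require Import zify ring lra.
Set Implicit Arguments.
Unset Strict Implicit.
Unset Printing Implicit Defensive.
Import Order.TTheory GRing.Theory Num.Theory.

(** * Root paths, ancestors and the sets of leaves below a vertex *)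

Section RootedTree.
Variable T : rooted_tree.
Implicit Types u v w : T.
Local Notation r := (troot T).

Definition root_path v : seq T := sval (cid (edge_tree r v)).

Lemma root_pathP v : [/\ path (@edge T) r (root_path v),
  uniq (r :: root_path v) & last r (root_path v) = v].
Proof. by rewrite /root_path; case: cid => p []. Qed.

Lemma root_path_unique v p : path (@edge T) r p -> uniq (r :: p) ->
  last r p = v -> root_path v = p.
Proof. by move=> pp up lp; rewrite /root_path; case: cid => q [_ uq] /=; apply: uq. Qed.

Lemma ancestorE u v : ancestor u v = (u \in r :: root_path v).
Proof.
apply/asboolP/idP => [[p [pp up lp]]|uv]; first by rewrite (root_path_unique pp up lp).
by exists (root_path v); case: (root_pathP v).
Qed.

(** Shortening any walk from the root to [v] gives a simple path, which is the root path by
    uniqueness. The root path has fewer than [#|T|] edges, so the search in [dist] reaches its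
    length. *)
Lemma levelE v : level v = size (root_path v).
Proof.
have [pp up lp] := root_pathP v.
rewrite /level /dist; set P := (P in find P _); set s := iota 0 _.
have mT : size (root_path v) < #|T|.
  by have := max_card [in r :: root_path v]; rewrite (card_uniqP up).
have nthm k : k < #|T| -> nth 0 s k = k by move=> ?; rewrite nth_iota.
have Pm : P (size (root_path v)) by apply/asboolP; exists (root_path v).
have hasPs : has P s by apply/hasP; exists (size (root_path v)); rewrite // mem_iota.
apply/eqP; rewrite eqn_leq; apply/andP; split.
  by rewrite leqNgt; apply/negP => /(before_find 0); rewrite nthm // Pm.
have := nth_find 0 hasPs; rewrite nthm; last by rewrite -[X in _ < X](size_iota 0) -has_find.
move=> /asboolP[p [<- qp lq]].
move: lq; case/shortenP: qp => q qq uq sub lq.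
by rewrite (root_path_unique qq uq lq); apply: uniq_leq_size sub; case/andP: uq.
Qed.

Lemma root_path_cat u v : ancestor u v -> exists q, root_path v = root_path u ++ q.
Proof.
have [pp up _] := root_pathP v; rewrite ancestorE => uv.
case/splitPl: uv pp up => p1 p2 l1.
rewrite cat_path -cat_cons cat_uniq => /andP[pp _] /andP[up _].
by exists p2; rewrite (root_path_unique pp up l1).
Qed.

Lemma ancestor_refl v : ancestor v v.
Proof. by rewrite ancestorE -{1}(let: And3 _ _ e := root_pathP v in e) mem_last. Qed.

Lemma ancestor_root v : ancestor r v.
Proof. by rewrite ancestorE mem_head. Qed.

Lemma ancestor_trans : transitive (@ancestor T).
Proof.
move=> v u w uv /root_path_cat[q e].
by move: uv; rewrite !ancestorE e -cat_cons mem_cat => ->.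
Qed.

Lemma ancestor_level u v : ancestor u v -> level u <= level v.
Proof. by case/root_path_cat=> q e; rewrite !levelE e size_cat leq_addr. Qed.

Lemma ancestor_level_eq u v : ancestor u v -> level v <= level u -> u = v.
Proof.
case/root_path_cat=> q e; rewrite !levelE e size_cat => le.
have /size0nil q0 : size q = 0 by lia.
have [_ _ <-] := root_pathP u; have [_ _ <-] := root_pathP v.
by rewrite e q0 cats0.
Qed.

Lemma ancestor_anti u v : ancestor u v -> ancestor v u -> u = v.
Proof. by move=> uv /ancestor_level; exact: ancestor_level_eq. Qed.

(** The root paths of [u] and [v] are both prefixes of that of [w], so the shorter is a prefix of
    the longer. *)
Lemma ancestor_chain u v w :
  ancestor u w -> ancestor v w -> level u <= level v -> ancestor u v.
Proof.
case/root_path_cat=> p ep /root_path_cat[q eq]; rewrite !levelE => le.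
have e : root_path u = take (size (root_path u)) (root_path v).
  by rewrite -(takel_cat q le) -eq ep take_size_cat.
have [_ _ lu] := root_pathP u.
rewrite ancestorE -{}lu e -cat1s.
by have := mem_last r (take (size (root_path u)) (root_path v)); rewrite !inE;
  case/orP=> [->//|/mem_take ->]; rewrite orbT.
Qed.

Lemma level_card v : level v = #|[pred u | (u != r) && ancestor u v]|.
Proof.
have [_ /andP[rp up] _] := root_pathP v.
rewrite levelE -(card_uniqP up); apply: eq_card => u; rewrite inE ancestorE inE.
by case: eqP => // ->; apply/negbTE.
Qed.

Lemma ancestor_join u v w : ancestor u (join v w) = ancestor u v && ancestor u w.
Proof.
rewrite /join; case: arg_maxnP => [|j /andP[jv jw] jmax]; first by rewrite !ancestor_root.
apply/idP/andP => [uj|[uv uw]]; first by split; apply: ancestor_trans uj _.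
by apply: (ancestor_chain uv jv); apply: jmax; rewrite uv uw.
Qed.

Lemma level_join v w :
  level (join v w) = #|[pred u | [&& u != r, ancestor u v & ancestor u w]]|.
Proof. by rewrite level_card; apply: eq_card => u; rewrite !inE ancestor_join. Qed.

Lemma childrenP v w : reflect (root_path w = rcons (root_path v) w) (w \in children v).
Proof.
have [pv uv lv] := root_pathP v; have [pw uw lw] := root_pathP w.
rewrite inE; apply: (iffP andP) => [[evw avw]|e].
  apply: root_path_unique; rewrite ?last_rcons ?rcons_path ?pv ?lv //.
  rewrite -rcons_cons rcons_uniq uv andbT -ancestorE.
  by apply/negP => awv; move: evw; rewrite (ancestor_anti avw awv) edge_irr.
split; first by move: pw; rewrite e rcons_path lv => /andP[].
by rewrite ancestorE e -rcons_cons mem_rcons inE -ancestorE ancestor_refl orbT.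
Qed.

Lemma children_ancestor v w : w \in children v -> ancestor v w.
Proof. by rewrite inE => /andP[]. Qed.

Lemma children_level v w : w \in children v -> level w = (level v).+1.
Proof. by move=> /childrenP e; rewrite !levelE e size_rcons. Qed.

Lemma children_common v w w' x : w \in children v -> w' \in children v ->
  ancestor w x -> ancestor w' x -> w = w'.
Proof.
move=> /children_level lw /children_level lw' wx w'x.
apply: ancestor_level_eq; rewrite ?lw ?lw' //.
by apply: ancestor_chain wx w'x _; rewrite lw lw'.
Qed.

Lemma child_towards u v : ancestor u v -> u != v ->
  exists2 w, w \in children u & ancestor w v.
Proof.
have [pu uu lu] := root_pathP u; have [pv uv lv] := root_pathP v.
case/root_path_cat=> -[|w q] e neq.
  by move: neq; rewrite -lu -lv e cats0 eqxx.
have ew : root_path w = rcons (root_path u) w.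
  apply: root_path_unique; rewrite ?last_rcons //.
    by move: pv; rewrite e -cat_rcons cat_path => /andP[].
  by move: uv; rewrite e -cat_rcons -cat_cons cat_uniq => /andP[].
exists w; first exact/childrenP.
by rewrite ancestorE e !(inE, mem_cat) eqxx !orbT.
Qed.

Definition below u : {set T} := [set l in leaves T | ancestor u l].

Lemma in_leaves v : (v \in leaves T) = (children v == set0).
Proof. by rewrite inE. Qed.

Lemma below_leaves u : below u \subset leaves T.
Proof. by apply/subsetP => l; rewrite inE => /andP[]. Qed.

Lemma below_root : below r = leaves T.
Proof. by apply/setP => l; rewrite inE ancestor_root andbT. Qed.

Lemma below_leaf v : v \in leaves T -> below v = [set v].
Proof.
move=> vl; apply/setP => l; rewrite [LHS]inE [RHS]inE.
apply/andP/eqP => [[_ vl']|->]; last by rewrite ancestor_refl.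
apply/esym/eqP; apply: contraLR vl => /(child_towards vl')[w wv _].
by rewrite in_leaves; apply/set0Pn; exists w.
Qed.

Lemma below_subset u v : ancestor u v -> below v \subset below u.
Proof.
move=> uv; apply/subsetP => l; rewrite !inE => /andP[-> vl].
exact: ancestor_trans vl.
Qed.

(** A deepest descendant of [u] has no children. *)
Lemma below_neq0 u : below u != set0.
Proof.
case: (@arg_maxnP T u (ancestor u) (@level T)) => [|l ul lmax]; first exact: ancestor_refl.
apply/set0Pn; exists l; rewrite inE ul andbT in_leaves.
apply/negPn/negP => /set0Pn[w wl].
have := lmax w (ancestor_trans ul (children_ancestor wl)).
by rewrite (children_level wl) /=; lia.
Qed.

(** A common leaf puts [u] and [v] on one root path, which makes them comparable. *)
Lemma below_laminar u v :
  [|| below u \subset below v, below v \subset below u | [disjoint below u & below v]].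
Proof.
case: (boolP [disjoint _ & _]); rewrite ?orbT // orbF => /pred0Pn[l /=].
rewrite !inE => /andP[/andP[_ ul] /andP[_ vl]].
case/orP: (leq_total (level u) (level v)) => le.
  by rewrite (below_subset (ancestor_chain ul vl le)) orbT.
by rewrite (below_subset (ancestor_chain vl ul le)).
Qed.

Hypothesis children_neq1 : forall v, #|children v| <> 1.

(** The child of [u] towards [v] has a sibling [w'], and a leaf below [w'] is not below [v]. *)
Lemma below_proper u v : ancestor u v -> u != v -> below v \proper below u.
Proof.
move=> uv neq; rewrite properE below_subset //=; apply/subsetPn.
have [w wu wv] := child_towards uv neq.
have /set0Pn[w'] : children u :\ w != set0.
  have := @children_neq1 u; rewrite -card_gt0 (cardsD1 w) wu; lia.
rewrite in_setD1 => /andP[w'w w'u].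
have /set0Pn[l] := below_neq0 w'; rewrite inE => /andP[ll w'l].
exists l; rewrite inE ll /=; first exact: ancestor_trans (children_ancestor w'u) w'l.
apply: contraNN w'w => vl; apply/eqP.
exact: (children_common w'u wu w'l (ancestor_trans wv vl)).
Qed.

Lemma below_inj : injective below.
Proof.
move=> u v e; have /set0Pn[l lu] := below_neq0 u.
have lv : l \in below v by rewrite -e.
move: lu lv; rewrite !inE => /andP[_ ul] /andP[_ vl].
apply/eqP/negPn/negP => neq.
case/orP: (leq_total (level u) (level v)) => le.
  by have := below_proper (ancestor_chain ul vl le) neq; rewrite e properxx.
by have := below_proper (ancestor_chain vl ul le); rewrite eq_sym e properxx => /(_ neq).
Qed.

Lemma card_below_internal u : u \notin leaves T -> 2 <= #|below u|.
Proof.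
rewrite in_leaves => /set0Pn[w wu].
have neq : u != w by apply/eqP => e; have := children_level wu; rewrite e; lia.
have := proper_card (below_proper (children_ancestor wu) neq).
by have := below_neq0 w; rewrite -card_gt0; lia.
Qed.

End RootedTree.

(** * Counting in laminar families, and transversals of chains of sets *)

Section Laminar.
Variable L : finType.
Implicit Types (A B : {set L}) (F : {set {set L}}).

Definition laminar F := forall A B, A \in F -> B \in F ->
  [|| A \subset B, B \subset A | [disjoint A & B]].

(* Remove a set A0 of minimum size from F, and one of its points from all other
   sets: these strictly contain A0 or avoid the point, so no set drops below
   size k and no two sets become equal. *)
Lemma laminar_card (U : {set L}) F k : 1 < k -> laminar F ->
  (forall A, A \in F -> A \subset U) -> (forall A, A \in F -> k <= #|A|) ->
  #|F| <= #|U|.+1 - k.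
Proof.
move=> k1; have [m] := ubnP #|F|; elim: m F U => // m IH F U Fm lamF FU Fk.
have [->|/set0Pn[A1 A1F]] := eqVneq F set0; first by rewrite cards0.
have [A0 A0F A0min] := @arg_minnP _ A1 [in F] (fun A => #|A|) A1F.
have A0k := Fk _ A0F.
have /set0Pn[l lA0] : A0 != set0 by rewrite -card_gt0; lia.
have above B : B \in F -> B != A0 -> l \in B -> A0 \proper B.
  move=> BF BA0 lB; case/or3P: (lamF _ _ A0F BF) => [sub|sub|].
  - by rewrite properEneq eq_sym BA0.
  - by case/negP: BA0; rewrite eqEcard sub A0min.
  - by move/pred0P/(_ l); rewrite /= lA0 lB.
(* Equality would put [A0 :\ l], nonempty since [1 < k], inside [C]. So [A0] and [C] meet, and
   laminarity gives either [l \in C] or, by minimality, [C = A0]. *)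
have distinct B C : B \in F -> C \in F -> B != A0 -> C != A0 -> l \in B -> l \notin C ->
    B :\ l != C :\ l.
  move=> BF CF BA0 CA0 lB lC; apply/eqP => e.
  have : A0 :\ l \subset C :\ l by rewrite -e setSD // proper_sub // above.
  have -> : C :\ l = C by apply/setDidPl; rewrite disjoint_sym disjoints1.
  move=> sub; case/or3P: (lamF _ _ A0F CF) => [sub'|sub'|dis].
  - by case/negP: lC; apply: (subsetP sub').
  - by case/negP: CA0; rewrite eqEcard sub' A0min.
  - have : A0 :\ l != set0 by have := cardsD1 l A0; rewrite lA0 -card_gt0; lia.
    case/set0Pn=> z zA; have := subsetP sub z zA.
    move: zA; rewrite in_setD1 => /andP[_ zA0] zC.
      by move/pred0P/(_ z): dis; rewrite /= zA0 zC.
pose F' := [set B :\ l | B in F :\ A0].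
have F'P A : A \in F' -> exists2 B, (B \in F) && (B != A0) & A = B :\ l.
  by case/imsetP=> B; rewrite in_setD1 andbC => ? ->; exists B.
have cF' : #|F'| = #|F :\ A0|.
  apply: card_in_imset => B C; rewrite !in_setD1 => /andP[BA0 BF] /andP[CA0 CF] e.
  case: (boolP (l \in B)) (boolP (l \in C)) => lB [] lC.
  - by rewrite -(setD1K lB) -(setD1K lC) e.
  - by case/eqP: (distinct _ _ BF CF BA0 CA0 lB lC).
  - by case/eqP: (distinct _ _ CF BF CA0 BA0 lC lB).
  - by move: e; rewrite !(setDidPl _) // disjoint_sym disjoints1.
have cF : #|F| = #|F'|.+1 by rewrite (cardsD1 A0) A0F cF'.
have lU : l \in U by apply: (subsetP (FU _ A0F)).
suff : #|F'| <= #|U :\ l|.+1 - k.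
  have := subset_leq_card (FU _ A0F).
  by rewrite cF (cardsD1 l U) lU; lia.
apply: IH; first by rewrite -ltnS -cF.
- move=> _ _ /F'P[B /andP[BF _] ->] /F'P[C /andP[CF _] ->].
  case/or3P: (lamF _ _ BF CF) => h; rewrite ?(setSD _ h) ?orbT //.
  by rewrite (disjointWl (subD1set _ _)) ?orbT // (disjointWr (subD1set _ _)).
- by move=> _ /F'P[B /andP[BF _] ->]; rewrite setSD // FU.
- move=> _ /F'P[B /andP[BF BA0] ->].
  have := cardsD1 l B; have := Fk _ BF.
  by case: (boolP (l \in B)) => [/(above _ BF BA0)/proper_card|]; lia.
Qed.

(** Each set of the chain contributes one point outside its predecessor. For a caterpillar this
    yields the order in which the values are placed on the leaves. *)
Lemma proper_chain_transversal A (p : seq {set L}) :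
  A != set0 -> path (fun B C : {set L} => B \proper C) A p ->
  exists c : seq L, [/\ uniq c, size c = (size p).+1 &
    forall j, j <= size p -> {subset take j.+1 c <= nth A (A :: p) j}].
Proof.
move=> /set0Pn[a aA]; elim/last_ind: p => [_|p B IH].
  by exists [:: a]; split=> // -[|//] _ z; rewrite inE => /eqP ->.
rewrite rcons_path => /andP[/IH[c [uc sc subc]] /properP[sub [b bB bp]]].
have bc : b \notin c.
  apply: contra bp => bc; rewrite (last_nth A); apply: subc => //.
  by rewrite take_oversize ?sc.
exists (rcons c b); rewrite rcons_uniq bc uc !size_rcons sc; split=> // j.
rewrite leq_eqVlt => /orP[/eqP->|].
  have subB : {subset c <= B}.
    move=> z zc; apply: (subsetP sub).
    by rewrite (last_nth A); apply: subc => //; rewrite take_oversize ?sc.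
  rewrite take_oversize ?size_rcons ?sc // -rcons_cons nth_rcons ltnn eqxx => z.
  by rewrite mem_rcons inE => /orP[/eqP->|/subB].
rewrite ltnS => jp; rewrite -cats1 takel_cat ?sc // -rcons_cons nth_rcons ltnS jp.
exact: subc.
Qed.

End Laminar.

(** * Inequalities between finite sums *)

Section Sums.
Variable R : realType.
Local Open Scope ring_scope.

(* By the counting hypothesis the largest rank is at most n, the second largest
   at most n - 1, and so on. *)
Lemma sum_le_ranks (I : finType) (F : {set I}) (g : I -> nat) (n : nat) (f : nat -> R) :
  (forall k, (1 < k)%N -> (#|[set i in F | k <= g i]| <= n.+1 - k)%N) ->
  (forall i, i \in F -> (1 < g i)%N) ->
  (forall k, 0 <= f k) -> {homo f : j k / (j <= k)%N >-> j <= k} ->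
  \sum_(i in F) f (g i) <= \sum_(2 <= k < n.+1) f k.
Proof.
move=> cF g1 f0 fmono; elim: n F cF g1 => [|n IH] F cF g1.
  suff -> : F = set0 by rewrite big_set0 big_geq.
  apply/setP => i; rewrite inE; apply/negbTE/negP => iF.
  have := cF 2 isT; rewrite leqn0 cards_eq0 => /eqP/setP/(_ i).
  by rewrite !inE iF g1.
have [->|/set0Pn[i1 i1F]] := eqVneq F set0; first by rewrite big_set0 sumr_ge0.
have [i0 i0F i0max] := @arg_maxnP _ i1 [in F] g i1F.
have gn : (g i0 <= n.+1)%N.
  have := cF _ (g1 _ i0F).
  by rewrite (cardsD1 i0) !inE i0F leqnn /=; lia.
rewrite (big_setD1 i0) //= addrC big_nat_recr; last by have := g1 _ i0F; lia.
rewrite lerD ?fmono // IH // => [k k1|i]; last by rewrite !inE => /andP[_ /g1].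
(* If [k <= g i0], then [i0] was counted and its removal lowers the count by one; for larger [k]
   nothing is counted, as [g i0] is maximal. *)
have [kg|kg] := leqP k (g i0).
  have := cF _ k1; rewrite (cardsD1 i0) inE i0F kg /=.
  rewrite (_ : _ :\ i0 = [set i in F :\ i0 | (k <= g i)%N]); first lia.
  by apply/setP => i; rewrite !inE andbA.
rewrite (_ : [set _ in _ | _] = set0) ?cards0 //; apply/setP => i; rewrite !inE.
apply/negbTE/negP => /andP[/andP[_ iF]]; have := i0max i iF; rewrite /=; lia.
Qed.

(** If the head [a] of [e] is in [A], remove it from both. Otherwise [A] lies in the tail, and
    replacing the last of the first [#|A|] entries of the tail by the larger [a] can only increase
    the sum. *)
Lemma sum_le_top (L : finType) (x : L -> R) (e : seq L) (A : {set L}) :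
  uniq e -> sorted (fun a b => x b <= x a) e -> {subset A <= e} ->
  \sum_(l in A) x l <= \sum_(l <- take #|A| e) x l.
Proof.
elim: e A => [|a e IH] A /=.
  move=> _ _ Ae; rewrite (_ : A = set0) ?big_set0 ?cards0 ?big_nil //.
  by apply/setP => l; rewrite inE; apply/negbTE/negP => /Ae.
move=> /andP[ae ue] se Ae; have se' := path_sorted se.
have [aA|aA] := boolP (a \in A).
  rewrite (big_setD1 a) //= (cardsD1 a) aA add1n /= big_cons lerD2l IH // => l.
  by rewrite !inE => /andP[la /Ae]; rewrite inE (negbTE la).
have {}Ae : {subset A <= e}.
  by move=> l lA; have := Ae _ lA; rewrite inE => /orP[/eqP la|//]; rewrite -la lA in aA.
apply: (le_trans (IH _ ue se' Ae)).
case cA : #|A| => [|k] /=; first by rewrite take0 !big_nil.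
have ke : (k < size e)%N.
  by rewrite -cA cardE; apply: uniq_leq_size (enum_uniq _) _ => l; rewrite mem_enum => /Ae.
rewrite (take_nth a) // -cats1 big_cat big_seq1 /= big_cons addrC lerD2r.
have tr : transitive (fun a b => x b <= x a) by move=> ? ? ? h1 h2; exact: le_trans h2 h1.
by have /allP := order_path_min tr se; apply; exact: mem_nth.
Qed.

Lemma sum_subset_le (L : finType) (y : L -> R) (c : seq L) (A : {set L}) :
  (forall l, 0 <= y l) -> uniq c -> {subset c <= A} ->
  \sum_(l <- c) y l <= \sum_(l in A) y l.
Proof.
move=> y0 uc cA; rewrite (big_uniq _ uc) /= [leRHS](bigID [in c]) /=.
rewrite -[leLHS]addr0 lerD ?sumr_ge0 // le_eqVlt; apply/orP; left; apply/eqP.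
by apply: eq_bigl => l; case: (boolP (l \in c)) => [/cA ->|]; rewrite ?andbF.
Qed.

Lemma sum_support (L : finType) (h : L -> R) (c : seq L) (A : {set L}) :
  (forall l, l \notin c -> h l = 0) -> uniq c -> {subset c <= A} ->
  \sum_(l in A) h l = \sum_(l <- c) h l.
Proof.
move=> h0 uc cA; rewrite (big_uniq _ uc) /= (bigID [in c]) /=.
rewrite [X in _ + X]big1 => [|l /andP[_]]; last exact: h0.
rewrite addr0.
by apply: eq_bigl => l; case: (boolP (l \in c)) => [/cA ->|]; rewrite ?andbF.
Qed.

End Sums.

(** * Rayleigh quotients of real symmetric matrices *)

Section RayleighQuotient.
Local Open Scope ring_scope.
Variables (R : realType) (m : nat).
Implicit Types (x y : 'rV[R]_m) (A B : 'M[R]_m).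

Definition rdot x y : R := (x *m y^T) 0 0.
Local Notation "x '*d y" := (rdot x y) (at level 40).

Lemma rdotE x y : x '*d y = \sum_i x 0 i * y 0 i.
Proof. by rewrite /rdot mxE; apply: eq_bigr => i _; rewrite mxE. Qed.

Lemma rdotC x y : x '*d y = y '*d x.
Proof. by rewrite !rdotE; apply: eq_bigr => i _; rewrite mulrC. Qed.

Lemma rdotDl x y z : (x + y) '*d z = x '*d z + y '*d z.
Proof. by rewrite /rdot mulmxDl mxE. Qed.

Lemma rdotZl a x y : (a *: x) '*d y = a * (x '*d y).
Proof. by rewrite /rdot -scalemxAl mxE. Qed.

Lemma rdotDr x y z : x '*d (y + z) = x '*d y + x '*d z.
Proof. by rewrite rdotC rdotDl !(rdotC x). Qed.

Lemma rdotZr a x y : x '*d (a *: y) = a * (x '*d y).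
Proof. by rewrite rdotC rdotZl rdotC. Qed.

Lemma rdot_ge0 x : 0 <= x '*d x.
Proof. by rewrite rdotE sumr_ge0 // => i _; rewrite -expr2 sqr_ge0. Qed.

Lemma rdot_gt0 x : x != 0 -> 0 < x '*d x.
Proof.
move=> x0; rewrite lt_def rdot_ge0 andbT; apply: contraNN x0.
rewrite rdotE psumr_eq0 => [/allP h|i _]; last by rewrite -expr2 sqr_ge0.
apply/eqP/rowP => i; rewrite mxE; apply/eqP.
by have := h i (mem_index_enum i); rewrite -expr2 sqrf_eq0.
Qed.

Lemma rdot_mulmxl A x y : A^T = A -> (x *m A) '*d y = x '*d (y *m A).
Proof. by move=> sA; rewrite /rdot trmx_mul sA mulmxA. Qed.

Lemma psd_cauchy_schwarz B x y : B^T = B -> (forall z, 0 <= (z *m B) '*d z) ->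
  ((x *m B) '*d y) ^+ 2 <= ((x *m B) '*d x) * ((y *m B) '*d y).
Proof.
move=> sB Bpos.
set b := (x *m B) '*d y; set a := (x *m B) '*d x; set c := (y *m B) '*d y.
have q t : 0 <= t ^+ 2 * a + 2 * t * b + c.
  have := Bpos (t *: x + y).
  rewrite mulmxDl -scalemxAl !(rdotDl, rdotDr, rdotZl, rdotZr).
  rewrite (_ : (y *m B) '*d x = b); last by rewrite rdot_mulmxl // rdotC.
  rewrite -/a -/b -/c; congr (_ <= _); ring.
have a0 : 0 <= a := Bpos x.
have c0 : 0 <= c := Bpos y.
have [a_gt0|a_eq] := ltP 0 a.
  (* [- b / a] minimizes the quadratic polynomial in [q]. *)
  have e : a * ((- b / a) ^+ 2 * a + 2 * (- b / a) * b + c) = a * c - b ^+ 2.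
    by field; exact: lt0r_neq0.
  by have := mulr_ge0 a0 (q (- b / a)); rewrite e subr_ge0.
have {a_eq}a_eq : a = 0 by apply/eqP; rewrite eq_le a0 a_eq.
rewrite a_eq mul0r; have [->|b0] := eqVneq b 0; first by rewrite expr0n.
(* With [a = 0] the polynomial is affine in [t]; this [t] gives it the value -1. *)
have e : 2 * (- (c + 1) / (2 * b)) * b = - (c + 1) by field.
by have := q (- (c + 1) / (2 * b)); rewrite a_eq mulr0 add0r e; lra.
Qed.

(** [K0] is the squared Frobenius norm of [A], and Cauchy-Schwarz on each column bounds [x *m A].
    Adding 1 makes the constant positive and leaves room for the second bound, which follows from
    the nonnegative squared norms of [x *m A + x] and [x *m A - x]. *)
Lemma rdot_mulmx_bounded A : exists2 K, 0 < K &
  forall x, (x *m A) '*d (x *m A) <= K * (x '*d x) /\ `|(x *m A) '*d x| <= K * (x '*d x).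
Proof.
pose K0 := \sum_j (col j A)^T '*d (col j A)^T.
have K0_ge0 : 0 <= K0 by apply: sumr_ge0 => j _; exact: rdot_ge0.
exists (K0 + 1) => [|x]; first lra.
have le : (x *m A) '*d (x *m A) <= K0 * (x '*d x).
  rewrite mulr_suml rdotE ler_sum // => j _.
  have e : x '*d (col j A)^T = (x *m A) 0 j.
    by rewrite rdotE mxE; apply: eq_bigr => i _; rewrite !mxE.
  have := @psd_cauchy_schwarz 1%:M x (col j A)^T (trmx1 _ _).
  rewrite !mulmx1 e -expr2 [_ * rdot x x]mulrC; apply=> z.
  by rewrite mulmx1 rdot_ge0.
have x0 := rdot_ge0 x; have y0 := rdot_ge0 (x *m A).
have p0 := rdot_ge0 (x *m A + x); have n0 := rdot_ge0 (x *m A - x).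
move: p0 n0; rewrite -scaleN1r !(rdotDl, rdotDr, rdotZl, rdotZr) (rdotC x (x *m A)) => p0 n0.
by split; rewrite ?ler_norml; nra.
Qed.

(* If the supremum a of the Rayleigh quotients were not an eigenvalue, the
   positive semidefinite matrix B = a - A would be invertible, and
   |x|^2 <= K |xB|^2 <= K M (xB.x) would make a - 1/(KM) an upper bound too. *)
Lemma largest_eigenvalue_rayleigh A : A^T = A -> (0 < m)%N ->
  exists2 a, eigenvalue A a & forall x, (x *m A) '*d x <= a * (x '*d x).
Proof.
move=> sA m0.
pose S : set R := [set t | exists2 x, x '*d x = 1 & t = (x *m A) '*d x]%classic.
have [K0 K0_gt0 bA] := rdot_mulmx_bounded A.
have normalize x : x != 0 -> exists2 k, 0 < k & (k *: x) '*d (k *: x) = 1.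
  move=> /rdot_gt0 x0; exists (Num.sqrt (x '*d x))^-1; first by rewrite invr_gt0 sqrtr_gt0.
  rewrite rdotZl rdotZr mulrA -expr2 exprVn sqr_sqrtr ?(ltW x0) // mulVf //.
  exact: lt0r_neq0.
have S0 : (S !=set0)%classic.
  have [|k _ e] := normalize (const_mx 1).
    apply/eqP => /rowP /(_ (Ordinal m0)); rewrite !mxE => /eqP; exact/negP/oner_neq0.
  by exists ((k *: const_mx 1 *m A) '*d (k *: const_mx 1)); exists (k *: const_mx 1).
have Sub : has_sup S.
  split=> //; exists K0 => _ [x x1 ->].
  have [_] := bA x; rewrite x1 mulr1; apply: le_trans; exact: ler_norm.
set a := sup S.
have aA x : (x *m A) '*d x <= a * (x '*d x).
  have [->|/normalize[k k0 e]] := eqVneq x 0.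
    by rewrite mul0mx !rdotE !big1 ?mulr0 // => i _; rewrite !mxE mul0r.
  have : (k *: x *m A) '*d (k *: x) <= a.
    by apply: ub_le_sup; [case: Sub | exists (k *: x)].
  rewrite -[leRHS]mulr1 -e -scalemxAl !rdotZl !rdotZr !mulrA -[a * k * k]mulrA [a * _]mulrC.
  by rewrite -[leRHS]mulrA -[leRHS]mulrA -[leLHS]mulrA !ler_pM2l.
exists a => //; pose B := a%:M - A.
have sB : B^T = B by rewrite /B linearB /= tr_scalar_mx sA.
have BE x : (x *m B) '*d x = a * (x '*d x) - (x *m A) '*d x.
  rewrite /B mulmxBr mul_mx_scalar rdotDl rdotZl -scaleN1r rdotZl; ring.
have Bpos x : 0 <= (x *m B) '*d x by rewrite BE subr_ge0.
have [uB|nB] := boolP (B \in unitmx); last first.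
  rewrite unitmxE unitfE negbK in nB; have /det0P[v v0 vB] := nB.
  apply/eigenvalueP; exists v => //; apply/esym/eqP.
  by rewrite -mul_mx_scalar -subr_eq0 -mulmxBr vB.
have [M M0 bB] := rdot_mulmx_bounded B.
have [K K_gt0 bV] := rdot_mulmx_bounded (invmx B).
(* Cauchy-Schwarz for the form of [B] at [x] and [x *m B] gives p^2 <= (xB.x)(xBB.xB) <= (xB.x) M p
   with p = |xB|^2; then divide by p. *)
have lower x : x '*d x <= K * M * ((x *m B) '*d x).
  have [h _] := bV (x *m B); rewrite mulmxK // in h.
  apply: (le_trans h); rewrite -mulrA ler_pM2l //.
  have := psd_cauchy_schwarz x (x *m B) sB Bpos.
  set p := (x *m B) '*d (x *m B) => cs.
  have [_ h2] := bB (x *m B); have := le_trans (ler_norm _) h2 => {h2} h2; rewrite -/p in h2.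
  have p0 : 0 <= p := rdot_ge0 _.
  have [p_gt0|p_le0] := ltP 0 p; last by apply: le_trans p_le0 _; rewrite mulr_ge0 // ltW.
  rewrite -(ler_pM2l p_gt0) -expr2; apply: (le_trans cs).
  have -> : p * (M * ((x *m B) '*d x)) = (x *m B) '*d x * (M * p) by ring.
  exact: ler_wpM2l.
have KM0 : 0 < K * M by rewrite mulr_gt0.
have ub : (ubound S (a - (K * M)^-1))%classic.
  move=> _ [x x1 ->]; have := lower x; rewrite BE x1 mulr1.
  rewrite -ler_pdivrMl // mulr1; lra.
have := ge_sup S0 ub; rewrite -/a lerDl oppr_ge0 invr_le0 leNgt KM0 //.
Qed.

End RayleighQuotient.

(** * The quadratic form of the ancestral matrix *)

Section AncestralForm.
Variables (R : realType) (T : rooted_tree).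
Local Open Scope ring_scope.
Implicit Types x : T -> R.

(** This is S(u). Functions on vertices stand for row vectors, so that sums run over sets of leaves
    instead of ordinals. *)
Definition weight x (u : T) : R := \sum_(l in below u) x l.
Definition leaf_row x : 'rV[R]_#|leaves T| := \row_i x (enum_val i).

Lemma leaf_row_surj (v : 'rV[R]_#|leaves T|) : exists x, v = leaf_row x.
Proof.
exists (fun l => \sum_(i | enum_val i == l) v 0 i).
apply/rowP => i; rewrite mxE (big_pred1 i) // => j.
by rewrite (inj_eq enum_val_inj).
Qed.

Lemma rdot_leaf_row x : rdot (leaf_row x) (leaf_row x) = \sum_(l in leaves T) x l ^+ 2.
Proof.
rewrite rdotE (big_enum_val (fun l => x l ^+ 2)).
by apply: eq_bigr => i _; rewrite !mxE expr2.
Qed.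

Lemma weightE x u :
  weight x u = \sum_(i < #|leaves T|) x (enum_val i) * (ancestor u (enum_val i))%:R.
Proof.
rewrite -(big_enum_val (fun l => x l * (ancestor u l)%:R)).
rewrite [RHS]big_mkcond [LHS]big_mkcond; apply: eq_bigr => l _.
by rewrite [_ \in below _]inE; case: (_ \in leaves T);
  case: ancestor; rewrite /= ?mulr1 ?mulr0.
Qed.

Lemma ancestral_mx_sym : (ancestral_mx R T)^T = ancestral_mx R T.
Proof.
apply/matrixP => i j; rewrite !mxE !level_join; congr (_%:R).
by apply: eq_card => u; rewrite !inE [ancestor u _ && _]andbC.
Qed.

(** Each matrix entry counts the common ancestors of two leaves other than the root; summing over
    the ancestor first leaves a square for each vertex. *)
Lemma ancestral_form x :
  rdot (leaf_row x *m ancestral_mx R T) (leaf_row x)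
    = \sum_(u | u != troot T) weight x u ^+ 2.
Proof.
rewrite rdotE.
transitivity (\sum_(j < #|leaves T|) \sum_(i < #|leaves T|) \sum_(u | u != troot T)
   (x (enum_val i) * (ancestor u (enum_val i))%:R) *
   (x (enum_val j) * (ancestor u (enum_val j))%:R)).
  apply: eq_bigr => j _; rewrite !mxE mulr_suml; apply: eq_bigr => i _.
  rewrite !mxE level_join -sum1_card natr_sum.
  rewrite (eq_bigl (fun u => (u != troot T) &&
    (ancestor u (enum_val i) && ancestor u (enum_val j)))) // big_mkcondr.
  rewrite mulr_sumr mulr_suml; apply: eq_bigr => u _.
  by do 2 case: ancestor; rewrite /=; ring.
rewrite exchange_big /=; under eq_bigr do rewrite exchange_big /=.
rewrite exchange_big; apply: eq_bigr => u _.
rewrite expr2 weightE mulr_suml; apply: eq_bigr => i _.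
by rewrite mulr_sumr.
Qed.

(** With the root included, the sum splits into leaves and internal vertices even when the root is a
    leaf. The subtracted term is the same for both trees in the comparison. *)
Lemma ancestral_formE x :
  rdot (leaf_row x *m ancestral_mx R T) (leaf_row x)
    = \sum_u weight x u ^+ 2 - (\sum_(l in leaves T) x l) ^+ 2.
Proof.
by rewrite ancestral_form [in RHS](bigD1 (troot T)) //= /weight below_root; ring.
Qed.

Lemma ancestral_form_norm x :
  rdot (leaf_row x *m ancestral_mx R T) (leaf_row x)
  <= rdot (leaf_row (fun l => `|x l|) *m ancestral_mx R T) (leaf_row (fun l => `|x l|)).
Proof.
rewrite !ancestral_form; apply: ler_sum => u _.
rewrite -(real_normK (num_real (weight x u))) ler_sqr ?nnegrE //.
  exact: ler_norm_sum.
exact: sumr_ge0.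
Qed.

Lemma sum_weight_split x : \sum_u weight x u ^+ 2 =
  \sum_(l in leaves T) x l ^+ 2 + \sum_(u in ~: leaves T) weight x u ^+ 2.
Proof.
rewrite (bigID [in leaves T]) /=; congr (_ + _).
  by apply: eq_bigr => l ll; rewrite /weight below_leaf // big_set1.
by apply: eq_bigl => u; rewrite !inE.
Qed.

(** Each weight is at most the prefix sum of length [#|below u|]. These sizes serve as ranks in
    [sum_le_ranks], whose counting hypothesis is [laminar_card], vertices being counted as sets
    through [below_inj]. *)
Lemma sum_weight_le_top x (e : seq T) :
  (forall v : T, #|children v| <> 1) -> (forall l, 0 <= x l) ->
  uniq e -> e =i leaves T -> sorted (fun a b => x b <= x a) e ->
  \sum_(u in ~: leaves T) weight x u ^+ 2
    <= \sum_(2 <= k < #|leaves T|.+1) (\sum_(l <- take k e) x l) ^+ 2.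
Proof.
move=> ch1 x0 ue eT se.
have P0 k : 0 <= \sum_(l <- take k e) x l by apply: sumr_ge0.
have Pmono : {homo (fun k => \sum_(l <- take k e) x l) : j k / (j <= k)%N >-> j <= k}.
  move=> j k jk; rewrite -[in leRHS](cat_take_drop j (take k e)) take_takel //.
  by rewrite big_cat lerDl sumr_ge0.
apply: (@le_trans _ _ (\sum_(u in ~: leaves T) (\sum_(l <- take #|below u| e) x l) ^+ 2)).
  apply: ler_sum => u _; rewrite ler_sqr ?nnegrE ?sumr_ge0 //.
  by apply: sum_le_top => // l lu; rewrite eT; apply: (subsetP (below_leaves u)).
apply: (@sum_le_ranks R T (~: leaves T) (fun u => #|below u|) #|leaves T|
          (fun k => (\sum_(l <- take k e) x l) ^+ 2)).
- move=> k k1; rewrite -(card_imset _ (below_inj ch1)).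
  apply: (@laminar_card _ (leaves T)) => //.
  + by move=> _ _ /imsetP[u _ ->] /imsetP[v _ ->]; exact: below_laminar.
  + by move=> _ /imsetP[u _ ->]; exact: below_leaves.
  + by move=> _ /imsetP[u uk ->]; move: uk; rewrite inE => /andP[].
- by move=> u; rewrite inE; exact: card_below_internal.
- by move=> k; exact: sqr_ge0.
- by move=> j k jk; rewrite ler_sqr ?nnegrE //; exact: Pmono.
Qed.

End AncestralForm.

(** * The chain of leaf sets in a caterpillar *)

Lemma binary_caterpillar_chain n (C : rooted_tree) : 0 < n -> binary_caterpillar n C ->
  exists s c : seq C,
    [/\ size s = n.-1, uniq s & s =i ~: leaves C] /\
    [/\ uniq c, size c = n, {subset c <= leaves C} &
      forall j, j < size s -> {subset take j.+2 c <= below (nth (troot C) s j)}].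
Proof.
move=> n0 [s [[sn us sl] [es hs s2]]].
have sI : s =i ~: leaves C by move=> v; rewrite sl !inE.
have ch1 (v : C) : #|children v| <> 1.
  have [vl|vl] := boolP (v \in leaves C).
    by move: vl; rewrite inE => /eqP ->; rewrite cards0.
  by rewrite s2 // sl.
have chain : sorted (fun u v : C => below v \proper below u) s.
  case: s es hs us {sn sl s2 sI} => //= a p es ha; rewrite {a}ha in es * => ua.
  apply/(pathP (troot C)) => i ip.
  (* The internal vertices form a simple path from the root, so its prefixes are root paths. *)
  have e : root_path (nth (troot C) p i) = take i.+1 p.
    apply: root_path_unique; first exact: take_path.
      by have := @take_uniq _ (troot C :: p) i.+2 ua.
    by rewrite (take_nth (troot C)) // last_rcons.
  apply: (below_proper ch1).
    rewrite ancestorE e -[_ :: take _ _]/(take i.+2 (troot C :: p)).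
    rewrite -(@nth_take i.+2) //.
    by apply: mem_nth; rewrite size_take /=; case: ifP; lia.
  rewrite -[nth _ p i]/(nth (troot C) (troot C :: p) i.+1) nth_uniq //=; lia.
(* The singleton of a leaf below the deepest internal vertex starts the chain, whence the offset
   [j.+2] in the conclusion. For [n = 1] the default of [last] is the root, itself the leaf. *)
have [l ll] : exists l, l \in below (last (troot C) s).
  by apply/set0Pn; exact: below_neq0.
pose q := map (@below C) (rev s).
have pq : path (fun A B : {set C} => A \proper B) [set l] q.
  rewrite /q; move: chain; rewrite -rev_sorted => chain.
  have : last (troot C) s = head (troot C) (rev s).
    by case/lastP: (s) => // p a; rewrite last_rcons rev_rcons.
  have : {subset rev s <= ~: leaves C} by move=> v; rewrite mem_rev sI.
  case: (rev s) chain => //= a p chain sub la; rewrite path_map chain andbT.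
  rewrite la in ll; rewrite properEcard sub1set ll cards1.
  by apply: card_below_internal => //; have := sub a (mem_head _ _); rewrite inE.
have [|c [uc sc subc]] := proper_chain_transversal _ pq.
  by apply/set0Pn; exists l; rewrite inE.
exists (rev s), c; split; split=> //.
- by rewrite size_rev.
- by rewrite rev_uniq.
- by move=> v; rewrite mem_rev sI.
- by rewrite sc size_map size_rev sn prednK.
- move=> z zc; have := subc (size q) (leqnn _) z; rewrite take_oversize ?sc // => /(_ zc).
  rewrite -last_nth.
  have : forall A, A \in [set l] :: q -> A \subset leaves C.
    move=> A; rewrite inE => /orP[/eqP->|/mapP[u _ ->]]; last exact: below_leaves.
    by rewrite sub1set (subsetP (below_leaves _) _ ll).
  by move=> /(_ _ (mem_last _ _))/subsetP; apply.
- move=> j js z zc; have := subc j.+1 _ z zc; rewrite /= (nth_map (troot C)) //; apply.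
  by rewrite size_map.
Qed.

(** * Comparison of the two largest eigenvalues *)

Section Comparison.
Variable R : realType.
Local Open Scope ring_scope.

(** The Rayleigh bound at an eigenvector shows that [a] bounds every eigenvalue, so [xget] returns a
    genuine largest eigenvalue. *)
Lemma rho_C_rayleigh (T : rooted_tree) : eigenvalue (ancestral_mx R T) (rho_C R T) /\
  forall v, rdot (v *m ancestral_mx R T) v <= rho_C R T * rdot v v.
Proof.
have leaves_gt0 : (0 < #|leaves T|)%N by rewrite card_gt0 -below_root below_neq0.
have [a ea aP] := largest_eigenvalue_rayleigh (ancestral_mx_sym R T) leaves_gt0.
have : largest_eigenvalue (ancestral_mx R T) (rho_C R T).
  apply: (xgetPex 0); exists a; split=> // b /eigenvalueP[v vA v0].
  by have := aP v; rewrite vA rdotZl ler_pM2r ?rdot_gt0.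
case=> erho /(_ _ ea) a_le; split=> // v.
by apply: le_trans (aP v) _; rewrite ler_wpM2r ?rdot_ge0.
Qed.

Lemma caterpillar_form_dominates n (T C : rooted_tree) (x : T -> R) :
  (0 < n)%N -> #|leaves T| = n -> (forall v : T, #|children v| <> 1%N) ->
  binary_caterpillar n C -> (forall l, 0 <= x l) ->
  exists y : C -> R, rdot (leaf_row y) (leaf_row y) = rdot (leaf_row x) (leaf_row x) /\
    rdot (leaf_row x *m ancestral_mx R T) (leaf_row x)
    <= rdot (leaf_row y *m ancestral_mx R C) (leaf_row y).
Proof.
move=> n0 cT ch1 hC x0.
have [s [c [[sn us sI] [uc sc cl take_c]]]] := binary_caterpillar_chain n0 hC.
pose e := sort (fun a b => x b <= x a) (enum (leaves T)).
have ue : uniq e by rewrite sort_uniq enum_uniq.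
have eT : e =i leaves T by move=> l; rewrite mem_sort mem_enum.
have se : sorted (fun a b => x b <= x a) e.
  by apply: sort_sorted => a b; exact: le_total.
have size_e : size e = n by rewrite size_sort -cardE.
(* The values of [x] in decreasing order are copied along [c], deepest leaves first. The value 0 off
   [c] reduces sums over the leaves of [C] to sums along [c]. *)
pose y (l : C) := if l \in c then nth 0 (map x e) (index l c) else 0.
have y0 l : 0 <= y l.
  rewrite /y; case: ifP => // lc; rewrite (nth_map (troot T)) //.
  by rewrite size_e -sc index_mem.
have y_out l : l \notin c -> y l = 0 by rewrite /y => /negbTE ->.
have yx : map y c = map x e.
  apply: (@eq_from_nth _ 0) => [|i]; rewrite !size_map ?sc ?size_e // => i_lt.
  by rewrite (nth_map (troot C)) ?sc // /y mem_nth ?sc // index_uniq ?sc.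
have sum_y (g : R -> R) k : \sum_(l <- take k c) g (y l) = \sum_(l <- take k e) g (x l).
  by rewrite -(big_map y xpredT) -(big_map x xpredT) !map_take yx.
have sum_leaves (g : R -> R) : g 0 = 0 ->
    \sum_(l in leaves C) g (y l) = \sum_(l in leaves T) g (x l).
  move=> g0; rewrite (sum_support _ uc cl) => [|l /y_out ->//].
  have := sum_y g n; rewrite !take_oversize ?sc ?size_e // => ->.
  by rewrite big_uniq //; apply: eq_bigl.
exists y; rewrite !rdot_leaf_row !ancestral_formE !sum_weight_split.
rewrite (sum_leaves (fun t => t ^+ 2)) ?expr0n // (sum_leaves id) //; split=> //.
rewrite lerB // lerD2l; apply: (le_trans (sum_weight_le_top ch1 x0 ue eT se)).
rewrite cT [leRHS](_ : _ = \sum_(u <- s) weight y u ^+ 2); last first.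
  by rewrite big_uniq //; apply: eq_bigl.
(* The shift k = j + 2 matches the prefix of length k with the internal vertex at index j, counted
   from the deepest. *)
rewrite (big_nth (troot C)) -[in leLHS](prednK n0) -sn.
rewrite big_add1 /= big_add1 /= !big_mkord; apply: ler_sum => j _.
rewrite ler_sqr ?nnegrE ?sumr_ge0 // -(sum_y id).
by apply: sum_subset_le; rewrite ?take_uniq //; exact: take_c.
Qed.

End Comparison.

Theorem theorem2p11 (R : realType) (n : nat) (T C : rooted_tree)
  (hn : 1 <= n)
  (hleaves : #|leaves T| = n)
  (hchildren : forall v : T, #|children v| <> 1)
  (hC : binary_caterpillar n C) :
  (rho_C R T <= rho_C R C)%R.
Proof.
have [/eigenvalueP[v vA v0] _] := rho_C_rayleigh R T.
have [_ rhoC] := rho_C_rayleigh R C.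
have [x vx] := leaf_row_surj v; rewrite {v}vx in vA v0.
have [y [yy xy]] := caterpillar_form_dominates hn hleaves hchildren hC
  (fun l => normr_ge0 (x l)).
have norm_x : rdot (leaf_row (fun l => `|x l|)%R) (leaf_row (fun l => `|x l|)%R)
              = rdot (leaf_row x) (leaf_row x).
  by rewrite !rdot_leaf_row; apply: eq_bigr => l _; rewrite real_normK ?num_real.
(* Since [x] gives an eigenvector, multiplying by its squared norm turns the left side into the form
   of [T] at [x]. *)
rewrite -(ler_pM2r (rdot_gt0 v0)) -rdotZl -vA.
apply: le_trans (ancestral_form_norm x) _.
by rewrite -norm_x -yy; exact: le_trans xy (rhoC _).
Qed.
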